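(* Let $\mathbb{K}\subseteq\mathbb{C}$ be a subfield (of characteristic $0$), let $n\geq 3$, and let $f\in\mathbb{K}[x_1,\dots,x_n]$ be a nonconstant polynomial. Let $\mathcal{X}_j=\sum_{m=1}^{n}P_{jm}\frac{\partial}{\partial x_m}$, $j=1,\dots,n-1$, be $n-1$ vector fields in $V_f^0$, let $\mathrm{M}$ be the $n\times(n-1)$ matrix whose $(m,j)$ entry is $P_{jm}$, and for $j=1,\dots,n$ let $M_j$ be the $(n-1)$-minor obtained by deleting the $j$-th row of $\mathrm{M}$. Suppose that: (1) the rank of $\mathrm{M}$ is $n-1$ at each point of $\mathbb{K}^n\setminus\Lambda_0$, where $\Lambda_0$ is an algebraic set of dimension $\leq n-2$; (2) the greatest common divisor of $\{M_1,\dots,M_n\}$ is $1$; (3) $f\in\langle f_{x_1},\dots,f_{x_n}\rangle$. Write $f=\sum_{m=1}^{n}Q_mf_{x_m}$ with $Q_m\in\mathbb{K}[x_1,\dots,x_n]$, and set $\mathcal{X}_*=\sum_{m=1}^{n}Q_m\frac{\partial}{\partial x_m}\in V_f$. Then the $\mathbb{K}[x_1,\dots,x_n]$-module $V_f$ is freely generated by $\mathcal{X}_1,\dots,\mathcal{X}_{n-1}$ and $\mathcal{X}_*$.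
   Context: Write $f_{x_j}=\frac{\partial f}{\partial x_j}$; $\langle f_{x_1},\dots,f_{x_n}\rangle$ is the ideal they generate in $\mathbb{K}[x_1,\dots,x_n]$. $V_f$ denotes the $\mathbb{K}[x_1,\dots,x_n]$-module of all polynomial vector fields $\mathcal{X}=\sum_{j=1}^{n}P_j\frac{\partial}{\partial x_j}$ with $P_j\in\mathbb{K}[x_1,\dots,x_n]$ for which there exists $k\in\mathbb{K}[x_1,\dots,x_n]$ (the cofactor) with $\sum_{j=1}^{n}P_jf_{x_j}=kf$. $V_f^0\subseteq V_f$ is the submodule of vector fields with cofactor $k\equiv0$, i.e. with $\sum_{j}P_jf_{x_j}=0$. ''Freely generated by'' means that the listed elements form a basis of the module. *)

(* Defs.v *)
From HB Require Import structures.
From mathcomp Require Import all_boot all_order all_algebra.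
From mathcomp Require Export ring_quotient reals complex mpoly.
Set Implicit Arguments. Unset Strict Implicit. Unset Printing Implicit Defensive.
Import GRing.Theory.
Local Open Scope ring_scope.

Section ModulesAndIdeals.
Variable R : comNzRingType.

(* [V] need not be given as a submodule: the first clause makes it the set of
   linear combinations of the family [e]. *)
Definition freely_generated_by (W : lmodType R) (V : W -> Prop)
    (I : finType) (e : I -> W) : Prop :=
  (forall v : W, V v <-> exists c : I -> R, v = \sum_(i : I) c i *: e i) /\
  (forall c : I -> R, \sum_(i : I) c i *: e i = 0 -> forall i : I, c i = 0).

Definition in_ideal (I : finType) (g : I -> R) (a : R) : Prop :=
  exists c : I -> R, a = \sum_(i : I) c i * g i.

Definition divides (d a : R) : Prop := exists q : R, a = q * d.

(* Greatest for divisibility, hence determined up to associates. *)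
Definition is_gcd (I : finType) (a : I -> R) (g : R) : Prop :=
  (forall i : I, divides g (a i)) /\
  (forall d : R, (forall i : I, divides d (a i)) -> divides d g).

End ModulesAndIdeals.

Section AlgebraicSets.
Variables (K : fieldType) (n : nat).

(* Points of K^n are row vectors [v]; [v 0] is the coordinate function
   ['I_n -> K] expected by polynomial evaluation. *)
Definition algebraic_set (L : 'rV[K]_n -> Prop) : Prop :=
  exists S : {mpoly K[n]} -> Prop,
    forall v : 'rV[K]_n, L v <-> (forall p : {mpoly K[n]}, S p -> p.@[v 0] = 0).

Definition vanishes_on (L : 'rV[K]_n -> Prop) (p : {mpoly K[n]}) : Prop :=
  forall v : 'rV[K]_n, L v -> p.@[v 0] = 0.

(* The Krull dimension of K[x_1, .., x_n] / I(L) is at most [d], where I(L) is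
   the vanishing ideal of [L]: a strictly increasing chain
   p_0 < p_1 < ... < p_m of prime ideals containing I(L) has m <= d.
   The empty set satisfies this for every [d]. *)
Definition dim_le (L : 'rV[K]_n -> Prop) (d : nat) : Prop :=
  forall (m : nat) (p : 'I_m.+1 -> prime_idealr {mpoly K[n]}),
    (forall (i : 'I_m.+1) (q : {mpoly K[n]}), vanishes_on L q -> q \in p i) ->
    (forall i j : 'I_m.+1, (i < j)%N ->
       {subset p i <= p j} /\ ~ {subset p j <= p i}) ->
    (m <= d)%N.

End AlgebraicSets.

Section VectorFields.
Variables (K : fieldType) (n : nat).

(* The row vector P = (P_1, .., P_n) stands for the polynomial vector field
   P_1 d/dx_1 + ... + P_n d/dx_n. *)
Definition vf_apply (P : 'rV[{mpoly K[n]}]_n) (f : {mpoly K[n]}) : {mpoly K[n]} :=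
  \sum_(j < n) P 0 j * f^`M(j).

Definition Vf (f : {mpoly K[n]}) (P : 'rV[{mpoly K[n]}]_n) : Prop :=
  exists k : {mpoly K[n]}, vf_apply P f = k * f.

Definition Vf0 (f : {mpoly K[n]}) (P : 'rV[{mpoly K[n]}]_n) : Prop :=
  vf_apply P f = 0.

Definition coef_mx (X : 'I_n.-1 -> 'rV[{mpoly K[n]}]_n) : 'M[{mpoly K[n]}]_(n, n.-1) :=
  \matrix_(m < n, j < n.-1) X j 0 m.

Definition minor_del (M : 'M[{mpoly K[n]}]_(n, n.-1)) (j : 'I_n) : {mpoly K[n]} :=
  \det (row' j M).

Definition eval_mx (M : 'M[{mpoly K[n]}]_(n, n.-1)) (v : 'rV[K]_n) :
    'M[K]_(n, n.-1) :=
  map_mx (fun p : {mpoly K[n]} => p.@[v 0]) M.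

End VectorFields.

(* Main.v *)
From HB Require Import structures.
Require Import Defs.
From mathcomp Require Import all_boot all_order all_algebra.
From mathcomp Require Import ring_quotient reals complex mpoly.
From mathcomp Require Import boolp ring.
Set Implicit Arguments. Unset Strict Implicit. Unset Printing Implicit Defensive.
Import GRing.Theory.
Local Open Scope ring_scope.

(** Subtracting [k *: Q] from a field with cofactor [k] leaves a field that
    kills [f], and [Q] itself has cofactor 1 and [f] is nonzero; so everything
    reduces to showing that the [X j] are a basis of the fields killing [f], that
    is, of the vectors orthogonal to the nonzero gradient [g] of [f].

    Independence only needs one nonzero minor, and the minors cannot all vanish
    since their gcd is 1.

    For generation, let [P] be orthogonal to [g]. Cramer's rule, applied to the
    rows other than the [l]-th, writes [M_l *: P] as a combination of the [X j]
    with polynomial coefficients [c_l j], for every [l]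
    ([minor_combination]). Independence then gives [M_l * c_i j = M_i * c_l j],
    so that a nonzero [M_i] divides [M_l * c_i j] for all [l]. In a factorial
    ring this forces [M_i] to divide [c_i j], because no prime factor of [M_i]
    divides all the [M_l] ([gcd1_divides]); the quotients are the coefficients
    of [P] ([kernel_generated]).

    It remains to see that polynomial rings over a field are factorial, in the
    form that every nonzero element is a unit times a product of prime
    elements. This is Gauss's theorem ([factorial_poly]), iterated through the
    isomorphism of K[x_1, .., x_(n+1)] with K[x_1, .., x_n][X]. In it,
    irreducibility over the fraction field is expressed by
    pseudo-divisibility over the ring itself, so that fractions never appear:
    [p %| q] for polynomials means that [p] divides some nonzero constant
    multiple of [q]. *)

(** * Prime elements and factorial rings *)

Section Divisibility.
Variable R : comNzRingType.
Implicit Types a b d p : R.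

Definition prime_element p : Prop :=
  [/\ p != 0, ~ divides p 1 &
      forall a b, divides p (a * b) -> divides p a \/ divides p b].

(** Inductive, so that factors can be cancelled one prime at a time. *)
Inductive prime_product : R -> Prop :=
| PrimeProductUnit u : divides u 1 -> prime_product u
| PrimeProductMul p a :
    prime_element p -> prime_product a -> prime_product (p * a).

Definition factorial : Prop := forall a, a != 0 -> prime_product a.

Lemma dividesMl d a b : divides d a -> divides d (b * a).
Proof. by case=> q ->; exists (b * q); rewrite mulrA. Qed.

Lemma dividesMr d a b : divides d a -> divides d (a * b).
Proof. by rewrite mulrC; apply: dividesMl. Qed.

Lemma divides_trans b a c : divides a b -> divides b c -> divides a c.
Proof. by move=> ab [q ->]; apply: dividesMl. Qed.

Lemma dividesD d a b : divides d a -> divides d b -> divides d (a + b).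
Proof. by case=> q -> [r ->]; exists (q + r); rewrite mulrDl. Qed.

Lemma divides_unit u a : divides u 1 -> divides u a.
Proof. by move=> u1; rewrite -[a]mulr1; apply: dividesMl. Qed.

Lemma prime_productM a b :
  prime_product a -> prime_product b -> prime_product (a * b).
Proof.
elim=> [u [v uv]|p {}a pp _ IH] hb; last first.
  by rewrite -mulrA; apply: PrimeProductMul => //; apply: IH.
elim: hb => [w [x wx]|p {}b pp _ IH].
  apply: PrimeProductUnit; exists (x * v).
  by transitivity ((v * u) * (x * w)); [rewrite -uv -wx mulr1 | ring].
by rewrite mulrCA; apply: PrimeProductMul.
Qed.

End Divisibility.

Section IntegralDomain.
Variable R : idomainType.
Implicit Types a b p : R.

(** Each prime of the product divides one of the two factors, from which it can
    be cancelled. Thanks to this lemma a polynomial may be multiplied by a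
    constant before it is factored. *)
Lemma prime_product_factor a b : prime_product (a * b) -> prime_product a.
Proof.
move Dc: (a * b) => c hc; elim: hc => [u [v uv]|p {}c pp hc IH] in a b Dc *.
  by apply: PrimeProductUnit; exists (v * b); rewrite uv -Dc; ring.
have [p0 _ pP] := pp.
have /pP[[q Da]|[q Db]] : divides p (a * b) by exists c; rewrite Dc mulrC.
  rewrite Da mulrC; apply: PrimeProductMul => //; apply: (IH q b).
  by apply: (mulfI p0); rewrite -Dc Da; ring.
by apply: (IH a q); apply: (mulfI p0); rewrite -Dc Db; ring.
Qed.

(** Cancel the primes [p] of [b] one by one: if [p] did not divide [a], it would
    divide every [M i]. *)
Lemma gcd1_divides (I : Type) (M : I -> R) b a :
    (forall d, (forall i, divides d (M i)) -> divides d 1) ->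
    prime_product b -> (forall i, divides b (M i * a)) -> divides b a.
Proof.
move=> gcd1 hb; elim: hb a => [u u1|p {}b pp _ IH] a dvd.
  exact: divides_unit.
have [p0 p1 pP] := pp.
have [[q Da]|pNa] := EM (divides p a).
  have [|r Dq] := IH q; last by exists r; rewrite Da Dq; ring.
  move=> i; have [r Dr] := dvd i; exists r; apply: (mulIf p0).
  by rewrite -mulrA -Da Dr; ring.
case: p1; apply: gcd1 => i.
have /pP[//|//] : divides p (M i * a).
by apply: divides_trans (dvd i); exists b; rewrite mulrC.
Qed.

End IntegralDomain.

(** * Gauss's theorem *)

Section ConstantPrimes.
Variable R : comNzRingType.
Implicit Types (p : R) (f g : {poly R}).

Lemma divides_polyCP p f : divides p%:P f <-> forall i, divides p f`_i.
Proof.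
split=> [[q ->] i|dvd]; first by rewrite coefMC; exists q`_i.
have [c Dc] := choice dvd.
exists (\poly_(i < size f) c i); apply/polyP=> i.
rewrite coefMC coef_poly; case: ltnP => [_|/leq_sizeP->//]; first exact: Dc.
by rewrite mul0r.
Qed.

Lemma divides_polyCMX p f : divides p%:P (f * 'X) -> divides p%:P f.
Proof.
by move=> /divides_polyCP dvd; apply/divides_polyCP=> i; have := dvd i.+1; rewrite coefMX.
Qed.

(** If [p] divides a product, it divides the product of the constant
    coefficients, hence one of them; the factor concerned may then be stripped
    of its constant coefficient and divided by ['X]. *)
Lemma prime_polyC p : prime_element p -> prime_element p%:P.
Proof.
case=> p0 p1 pP; split; first by rewrite polyC_eq0.
  by move/divides_polyCP/(_ 0%N); rewrite coef1.
have dvdC c : divides p c -> divides p%:P c%:P.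
  by case=> q ->; exists q%:P; rewrite polyCM.
elim/poly_ind=> [|f a IHf]; first by left; exists 0; rewrite mul0r.
elim/poly_ind=> [|g b IHg] dvd; first by right; exists 0; rewrite mul0r.
have dvdB (h k : {poly R}) : divides p%:P h -> divides p%:P (h + k) -> divides p%:P k.
  by move=> [q ->] [r Dr]; exists (r - q); rewrite mulrBl -Dr addrC addKr.
have /pP[pa|pb] : divides p (a * b).
  have /divides_polyCP/(_ 0%N) := dvd.
  by rewrite coef0M !coefD !coefMX !coefC !add0r.
- have [|pf|pg] := IHf (g * 'X + b%:P); [| |by right].
    apply: divides_polyCMX; rewrite mulrAC.
    apply: (dvdB (a%:P * (g * 'X + b%:P))); first by apply: dividesMr; apply: dvdC.
    by rewrite addrC -mulrDl.
  left; apply: dividesD; [exact: dividesMr | exact: dvdC].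
- have [|pf|pg] := IHg; [|by left|].
    apply: divides_polyCMX; rewrite -mulrA.
    apply: (dvdB ((f * 'X + a%:P) * b%:P)); first by apply: dividesMl; apply: dvdC.
    by rewrite addrC -mulrDr.
  right; apply: dividesD; [exact: dividesMr | exact: dvdC].
Qed.

Lemma prime_product_polyC (a : R) : prime_product a -> prime_product a%:P.
Proof.
elim=> [u [v uv]|p {}a pp _ IH]; last first.
  by rewrite polyCM; apply: PrimeProductMul IH; apply: prime_polyC.
by apply: PrimeProductUnit; exists v%:P; rewrite -polyCM -uv.
Qed.

End ConstantPrimes.

Section Gauss.
Variable R : idomainType.
Implicit Types (p : R) (f g : {poly R}).

Definition primitive g : Prop := forall d : R, divides d%:P g -> divides d 1.

(** The induction removes from [l] the primes that do not divide [f], and from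
    both [l] and [f] those that do. The leading coefficient of [f] is a possible
    initial [l]. *)
Lemma primitive_part l f :
    prime_product l -> (forall d : R, divides d%:P f -> divides d l) ->
  exists c g, f = c%:P * g /\ primitive g.
Proof.
move=> hl; elim: hl f => [u u1|p a pp _ IH] f dvd.
  by exists 1, f; split=> [|d /dvd du]; [rewrite mul1r | apply: divides_trans u1].
have [p0 p1 pP] := pp.
have [[f1 Df]|pNf] := EM (divides p%:P f).
  have [|c [g [Df1 primg]]] := IH f1; last first.
    by exists (c * p), g; split=> //; rewrite Df Df1 polyCM; ring.
  move=> d [q Dq]; have [|e De] := dvd (d * p).
    by exists q; rewrite Df Dq -mulrA polyCM.
  by exists e; apply: (mulfI p0); rewrite De; ring.
apply: IH => d df; have [e De] := dvd d df.
have /pP[[q Dq]|[q Dq]] : divides p (e * d) by exists a; rewrite -De mulrC.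
  exists q; apply: (mulfI p0); rewrite De Dq; ring.
case: pNf; apply: divides_trans df; exists q%:P; by rewrite Dq polyCM.
Qed.

(** If [d%:P * f = h * g], every prime of [d] divides [h], since it is prime in
    [{poly R}] and does not divide [g]. *)
Lemma primitive_divides_cancel d g f :
  prime_product d -> primitive g -> divides g (d%:P * f) -> divides g f.
Proof.
move=> hd primg; elim: hd f => [u [v uv]|p a pp _ IH] f [h Dh].
  by exists (v%:P * h); rewrite -mulrA -Dh mulrA -polyCM -uv mul1r.
have [p0 p1 pP] := pp; have [_ _ pCP] := prime_polyC pp.
have /pCP[[q Dq]|/primg//] : divides p%:P (h * g).
  by exists (a%:P * f); rewrite -Dh polyCM; ring.
apply: IH; exists q; apply: (@mulfI _ p%:P); first by rewrite polyC_eq0.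
by rewrite mulrA -polyCM Dh Dq; ring.
Qed.

(** Euclid's lemma over the fraction field gives divisibility of one factor up
    to a constant, and that constant can be cancelled. *)
Lemma primitive_irreducible_prime g :
  factorial R -> primitive g -> irreducible_poly g -> prime_element g.
Proof.
move=> facR primg irrg; split; first exact: irredp_neq0.
  case=> q D1; have [sg _] := irrg.
  by have := dvdp_mull q (dvdpp g); rewrite -D1 dvdp1 gtn_eqF.
move=> a b [q Dab].
have {q Dab}: (g %| a * b)%R by rewrite Dab dvdp_mull.
have dvd c : (g %| c)%R -> divides g c.
  move/Pdiv.WeakIdomain.dvdpP=> [[k h] /= k0 Dc].
  by apply: (primitive_divides_cancel (facR _ k0)) => //; exists h; rewrite mul_polyC.
have [ga _|gNa] := boolP (g %| a)%R; first by left; apply: dvd.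
by rewrite Gauss_dvdpr ?irreducible_poly_coprime // => /dvd; right.
Qed.

(** By induction on the degree: the content is factored in [R]; a nonconstant
    primitive part is prime if it is irreducible over the fraction field, and
    otherwise some constant multiple of it is a product of two polynomials of
    smaller degree. *)
Lemma factorial_poly : factorial R -> factorial {poly R}.
Proof.
move=> facR f; have [k] := ubnP (size f); elim: k f => // k IH f ltk f0.
have [||c [g [Df primg]]] := @primitive_part (lead_coef f) f.
- by apply: facR; rewrite lead_coef_eq0.
- by move=> d /divides_polyCP; apply.
have [c0 g0] : c != 0 /\ g != 0.
  by apply/andP; rewrite -negb_or -(polyC_eq0 c) -mulf_eq0 -Df.
rewrite Df; apply: prime_productM; first exact/prime_product_polyC/facR.
have {f0 ltk Df f} ltk : (size g <= k)%N.
  by move: ltk; rewrite Df mul_polyC size_scale // ltnS.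
have [irr|red] := EM (irreducible_poly g).
  rewrite -[g]mulr1; apply: PrimeProductMul; first exact: primitive_irreducible_prime.
  by apply: PrimeProductUnit; exists 1; rewrite mulr1.
have [sg|sg] := leqP (size g) 1.
  by rewrite (size1_polyC sg); apply/prime_product_polyC/facR;
    rewrite -polyC_eq0 -size1_polyC.
have [q /not_implyP[sq /not_implyP[qg /negP qNg]]] : exists q : {poly R},
    ~ (size q != 1%N -> (q %| g)%R -> (q %= g)%R).
  by apply/existsNP => all; apply: red.
have /Pdiv.WeakIdomain.dvdpP[[d h] /= d0 Dg] := qg.
have dg0 : d *: g != 0 by rewrite -mul_polyC mulf_neq0 // polyC_eq0.
have [h0 q0] : h != 0 /\ q != 0.
  by apply/andP; rewrite -negb_or -mulf_eq0 -Dg.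
have ltqg : (size q < size g)%N.
  by rewrite ltn_neqAle dvdp_leq // andbT dvdp_size_eqp.
apply: (@prime_product_factor _ g d%:P); rewrite mulrC mul_polyC Dg.
apply: prime_productM; apply: IH => //; last exact: leq_trans ltk.
apply: leq_trans ltk; rewrite -(size_scale g d0) Dg size_mul //.
move: sq q0; rewrite -size_poly_gt0; case: (size q) => [|[|m]] // _ _.
by rewrite !addnS /= ltnS leq_addr.
Qed.
End Gauss.

(** * Polynomial rings over a field *)

Lemma divides_rmorph (A B : comNzRingType) (phi : {rmorphism A -> B}) a b :
  divides a b -> divides (phi a) (phi b).
Proof. by case=> q ->; exists (phi q); rewrite rmorphM. Qed.

Lemma prime_element_iso (A B : comNzRingType) (phi : {rmorphism A -> B})
    (psi : {rmorphism B -> A}) (phiK : cancel phi psi) (psiK : cancel psi phi) p :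
  prime_element p -> prime_element (psi p).
Proof.
case=> p0 p1 pP; split.
- by apply: contra_neq p0 => /(congr1 phi); rewrite psiK rmorph0.
- by move/(divides_rmorph phi); rewrite psiK rmorph1.
move=> a b /(divides_rmorph phi); rewrite psiK rmorphM => /pP.
by case=> /(divides_rmorph psi); rewrite phiK; [left | right].
Qed.

Lemma factorial_iso (A B : comNzRingType) (phi : {rmorphism A -> B})
    (psi : {rmorphism B -> A}) (phiK : cancel phi psi) (psiK : cancel psi phi) :
  factorial B -> factorial A.
Proof.
move=> facB a a0; rewrite -[a]phiK.
have : phi a != 0 by apply: contra_neq a0 => /(congr1 psi); rewrite phiK rmorph0.
move/facB; elim=> [u u1|p b pp _ IH].
  by apply: PrimeProductUnit; rewrite -(rmorph1 psi); apply: divides_rmorph.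
by rewrite rmorphM; apply: PrimeProductMul IH; apply: (prime_element_iso phiK).
Qed.


Section MPoly.
Variables (n : nat) (K : comNzRingType).

(** The inverse of [muni], as a ring morphism. *)
Definition from_uni : {poly {mpoly K[n]}} -> {mpoly K[n.+1]} :=
  horner_morph (fun a : {mpoly K[n]} => mulrC 'X_ord_max (mwiden a)).

HB.instance Definition _ := GRing.RMorphism.on from_uni.

Lemma muniK : cancel (@muni n K) from_uni.
Proof.
move=> p; rewrite muniE rmorph_sum [RHS]mpolyE; apply: eq_bigr => m _ /=.
rewrite -mul_polyC rmorphM rmorphXn /= /from_uni horner_morphC horner_morphX /=.
rewrite mwidenZ mwidenX -scalerAl mpolyXn -mpolyXD; congr (_ *: 'X_[_]).
apply/mnmP=> i; rewrite mnmDE mulmnE mnm1E.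
case: (unliftP ord_max i) => [j|] ->.
  rewrite (_ : lift _ _ = widen_ord (leqnSn n) j); last first.
    by apply/val_inj; rewrite /= /bump leqNgt ltn_ord.
  rewrite mnmwiden_widen mnmE -val_eqE /= gtn_eqF ?mul0n ?addn0 //.
by rewrite mnmwiden_ordmax eqxx mul1n.
Qed.

Lemma from_uniK : cancel from_uni (@muni n K).
Proof.
elim/poly_ind=> [|p c IHp]; first by rewrite !rmorph0.
rewrite !rmorphD !rmorphM /= IHp; congr (_ * _ + _).
  rewrite /from_uni horner_morphX muniE msuppX big_seq1 mcoeffX eqxx mnm1E eqxx.
  rewrite scale1r expr1 (_ : [multinom _ | i < n] = 0%MM) ?mpolyX0 ?scale1r //.
  apply/mnmP=> i; rewrite !mnmE -val_eqE /= gtn_eqF //.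
rewrite /from_uni horner_morphC /= {1}[c]mpolyE [c in RHS]mpolyE.
rewrite (raddf_sum (@mwiden n K)) (raddf_sum (@muni n K)) (raddf_sum polyC).
apply: eq_bigr => m _ /=.
rewrite mwidenZ mwidenX muniZ muniE msuppX big_seq1 mcoeffX eqxx scale1r.
rewrite mnmwiden_ordmax expr0 alg_polyC -mul_polyC -polyCM mul_mpolyC.
congr (_ *: 'X_[_])%:P; apply/mnmP=> i; by rewrite mnmE mnmwiden_widen.
Qed.
End MPoly.

Lemma factorial_mpoly (K : fieldType) n : factorial {mpoly K[n]}.
Proof.
elim: n => [|n IHn]; last first.
  exact: factorial_iso (@muniK n K) (@from_uniK n K) (factorial_poly IHn).
move=> p p0; apply: PrimeProductUnit.
rewrite [p]nvar0_mpolyC in p0 *; exists (p@_0%MM)^-1%:MP.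
by rewrite -mpolyCM mulVf // -(mpolyC_eq0 0).
Qed.

(** * The kernel of a linear form *)

Lemma row'_mulmx (R : pzRingType) m n p (i : 'I_m) (A : 'M[R]_(m, n))
    (B : 'M[R]_(n, p)) :
  row' i (A *m B) = row' i A *m B.
Proof. by rewrite !row'Esub mul_rowsub_mx. Qed.

Section Kernel.
Variables (R : idomainType) (n : nat) (M : 'M[R]_(n, n.-1)) (g : 'rV[R]_n).
Hypothesis facR : factorial R.
Hypothesis gcd1 : forall d, (forall i, divides d (\det (row' i M))) -> divides d 1.

(** Otherwise 0 would be a common divisor of the minors. *)
Lemma minor_neq0 : exists i, \det (row' i M) != 0.
Proof.
apply/not_existsP => all0; have [i|q] := gcd1 (d := 0).
  by exists 0; rewrite mul0r; apply/eqP; apply: contra_notT (all0 i).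
by rewrite mulr0; apply/eqP; rewrite oner_eq0.
Qed.

Lemma col_free (c : 'cV[R]_n.-1) : M *m c = 0 -> c = 0.
Proof.
have [i Mi0] := minor_neq0 => Mc0.
have : row' i M *m c = 0.
  by rewrite -row'_mulmx Mc0; apply/matrixP=> a b; rewrite !mxE.
move/(congr1 (mulmx (\adj (row' i M)))).
rewrite mulmxA mul_adj_mx mulmx0 mul_scalar_mx => /eqP.
by rewrite scalemx_eq0 (negPf Mi0) => /eqP.
Qed.

Hypothesis g0 : g != 0.
Hypothesis gM : g *m M = 0.

(** Cramer's rule gives a [c] such that [M_i *: P] and [M *m c] agree outside row
    [i]. Their difference is orthogonal to [g], so row [i] agrees too when
    [g 0 i] is nonzero. When [g 0 i] vanishes, the other entries of [g] give a
    nontrivial relation between the rows of [row' i M], so [M_i] is 0. *)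
Lemma minor_combination (P : 'cV[R]_n) i :
  g *m P = 0 -> exists c, \det (row' i M) *: P = M *m c.
Proof.
move=> gP.
pose c := \adj (row' i M) *m row' i P.
pose D := \det (row' i M) *: P - M *m c.
have D'0 : row' i D = 0.
  have : row' i (M *m c) = \det (row' i M) *: row' i P.
    by rewrite row'_mulmx mulmxA mul_mx_adj mul_scalar_mx.
  move/matrixP=> E; apply/matrixP=> a b; have := E a b; rewrite !mxE => ->.
  by rewrite subrr.
have gD : g *m D = 0 by rewrite mulmxBr -scalemxAr gP scaler0 mulmxA gM mul0mx subrr.
have Dk k : k != i -> D k 0 = 0.
  rewrite eq_sym => /unlift_some[l -> _].
  by have /matrixP/(_ l 0) := D'0; rewrite !mxE.
have [gi0|gi0] := eqVneq (g 0 i) 0; last first.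
  exists c; apply/eqP; rewrite -subr_eq0; apply/eqP/matrixP=> k z.
  rewrite ord1 [RHS]mxE -[LHS]/(D k 0); have [->|/Dk//] := eqVneq k i.
  apply: (mulfI gi0); rewrite mulr0; have /matrixP/(_ 0 0) := gD.
  by rewrite mxE (bigD1 i) //= big1 ?addr0 => [->|k' /Dk ->]; rewrite ?mxE ?mulr0.
exists 0; rewrite mulmx0; suff -> : \det (row' i M) = 0 by rewrite scale0r.
have g'M : col' i g *m row' i M = 0.
  apply/matrixP=> a b; have /matrixP/(_ a b) := gM.
  rewrite ord1 !mxE (bigD1_ord i) //= gi0 mul0r add0r => E; rewrite -[RHS]E.
  by apply: eq_bigr => k _; rewrite !mxE.
have : \det (row' i M) *: col' i g = 0.
  by rewrite -mul_mx_scalar -mul_mx_adj mulmxA g'M mul0mx.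
move=> /eqP; rewrite scalemx_eq0 => /orP[/eqP //|/eqP/matrixP g'0].
case/eqP: g0; apply/rowP=> k; rewrite [RHS]mxE.
by case: (unliftP i k) => [l|] -> //; have := g'0 0 l; rewrite !mxE.
Qed.

(** The fractions [c_i j / M_i] given by Cramer's rule do not depend on [i], so
    their denominators divide the gcd of the minors. *)
Lemma kernel_generated (P : 'cV[R]_n) : g *m P = 0 -> exists c, P = M *m c.
Proof.
move=> gP; have [c Dc] := choice (fun i => minor_combination i gP).
have [i Mi0] := minor_neq0.
have cross l : \det (row' l M) *: c i = \det (row' i M) *: c l.
  apply/eqP; rewrite -subr_eq0; apply/eqP/col_free.
  by rewrite mulmxBr -!scalemxAr -!Dc !scalerA mulrC subrr.
have /choice[e De] j : divides (\det (row' i M)) (c i j 0).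
  apply: (gcd1_divides gcd1) => [|l]; first exact: facR.
  exists (c l j 0); have /matrixP/(_ j 0) := cross l.
  by rewrite !mxE mulrC => ->; rewrite mulrC.
exists (\col_j e j); apply/eqP; rewrite -subr_eq0; apply/eqP.
have : \det (row' i M) *: (P - M *m \col_j e j) = 0.
  rewrite scalerBr Dc scalemxAr -mulmxBr; apply/eqP.
  rewrite (_ : _ - _ = 0) ?mulmx0 //; apply/matrixP=> j z.
  by rewrite ord1 !mxE De mulrC subrr.
by move/eqP; rewrite scalemx_eq0 (negPf Mi0) => /eqP.
Qed.
End Kernel.

(** * Polynomial vector fields tangent to the hypersurface f = 0 *)

Theorem theorem6 (R : realType) (K : fieldType) (iota : {rmorphism K -> R[i]})
    (n : nat) (hn : (3 <= n)%N)
    (f : {mpoly K[n]}) (hf : ~ exists c : K, f = c%:MP)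
    (X : 'I_n.-1 -> 'rV[{mpoly K[n]}]_n) (hX : forall j : 'I_n.-1, Vf0 f (X j))
    (h1 : exists L0 : 'rV[K]_n -> Prop,
        [/\ algebraic_set L0, dim_le L0 (n - 2)
          & forall v : 'rV[K]_n, ~ L0 v -> \rank (eval_mx (coef_mx X) v) = n.-1])
    (h2 : is_gcd (fun j : 'I_n => minor_del (coef_mx X) j) 1)
    (h3 : in_ideal (fun j : 'I_n => f^`M(j)) f)
    (Q : 'rV[{mpoly K[n]}]_n) (hQ : f = \sum_(m < n) Q 0 m * f^`M(m)) :
  freely_generated_by (Vf f)
    (fun o : option 'I_n.-1 => if o is Some j then X j else Q).
Proof.
have f0 : f != 0 by apply/eqP => f0; apply: hf; exists 0; rewrite f0 mpolyC0.
pose g : 'rV[{mpoly K[n]}]_n := \row_j f^`M(j).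
have applyE P : vf_apply P f = (g *m P^T) 0 0.
  by rewrite mxE; apply: eq_bigr => j _; rewrite !mxE mulrC.
have combE (c : 'I_n.-1 -> {mpoly K[n]}) :
    \sum_j c j *: X j = (coef_mx X *m \col_j c j)^T.
  apply/rowP=> k; rewrite summxE !mxE; apply: eq_bigr => j _.
  by rewrite !mxE mulrC.
have optE (c : option 'I_n.-1 -> {mpoly K[n]}) :
    \sum_o c o *: (if o is Some j then X j else Q)
    = c None *: Q + \sum_j c (Some j) *: X j.
  rewrite (bigD1 None) //=; congr (_ + _).
  by rewrite (reindex_omap Some id) => [|[]] //=; apply: eq_bigl => j; rewrite eqxx.
have applyQ : vf_apply Q f = f by rewrite [RHS]hQ.
have gM : g *m coef_mx X = 0.
  apply/rowP=> j; have := hX j; rewrite /Vf0 applyE !mxE => hXj.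
  by rewrite -[RHS]hXj; apply: eq_bigr => k _; rewrite !mxE.
have g0 : g != 0.
  apply: contra_neq f0 => g0; by rewrite -applyQ applyE g0 mul0mx mxE.
have gcd1 := h2.2.
have apply_comb k P : vf_apply (k *: Q + P) f = k * f + vf_apply P f.
  rewrite applyE linearD linearZ mulmxDr -scalemxAr mxE [X in X + _]mxE.
  by rewrite -!applyE applyQ.
have apply_X c : vf_apply (\sum_j c j *: X j) f = 0.
  by rewrite applyE combE trmxK mulmxA gM mul0mx mxE.
split=> [P|c].
  split=> [[k DP]|[c ->]]; last first.
    by exists (c None); rewrite optE apply_comb apply_X addr0.
  have [|c Dc] := kernel_generated (@factorial_mpoly K n) gcd1 g0 gM
      (P := (P - k *: Q)^T).
    apply/matrixP=> a b; rewrite !ord1 -applyE addrC -scaleNr apply_comb DP mxE.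
    by rewrite mulNr addNr.
  exists (fun o => if o is Some j then c j 0 else k); rewrite optE combE.
  rewrite (_ : \col_j _ = c) -?Dc ?trmxK 1?addrC ?subrK //.
  by apply/matrixP=> a b; rewrite ord1 mxE.
rewrite optE => D0.
have cN : c None = 0.
  have := congr1 (fun P => vf_apply P f) D0; rewrite apply_comb apply_X addr0.
  rewrite [RHS]applyE trmx0 mulmx0 mxE => /eqP.
  by rewrite mulf_eq0 (negPf f0) orbF => /eqP.
move: D0; rewrite cN scale0r add0r combE => /(congr1 trmx).
rewrite trmxK trmx0 => /(@col_free _ _ _ gcd1) /matrixP D.
by case=> [j|//]; have := D j 0; rewrite !mxE.
Qed.
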